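(* Let $j,n \in \mathbb{N}$ and $0 \le r \le 1$ be arbitrary. Then $$\sum_{i=1}^n (i+r)^j \leq \frac{(n+r)^{j+1}}{j+1} + \frac{(n+r)^j}{2} + \frac{j(n+r)^{j-1}}{12}.$$
   Context: $\mathbb{N}=\{1,2,3,\dots\}$. *)

(* Defs.v *)
From mathcomp Require Import all_boot all_order all_algebra.
From mathcomp Require Import reals.
Set Implicit Arguments.
Unset Strict Implicit.
Unset Printing Implicit Defensive.

(* Main.v *)
Require Import Defs.
From mathcomp Require Import all_boot all_order all_algebra.
From mathcomp Require Import reals ring lra zify.
Import Order.TTheory GRing.Theory Num.Theory.
Local Open Scope ring_scope.

(** With [F] the right-hand side as a function of [x = n + r], it suffices that
    [F (y + 1) - F y >= (y + 1) ^ j] for [y >= 0]. In the expansion of the difference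
    of the two sides in powers of [y], the coefficient of [y ^ (j + 1 - k)] vanishes for
    [k <= 2] and is [j (j - 1) ... (j - k + 2) / k! * (k - 3) (k - 4) / 12 >= 0]
    for [k >= 3]. *)

Lemma exprD1n_bin (R : comNzRingType) (y : R) (n : nat) :
  (y + 1) ^+ n = \sum_(i < n.+1) 'C(n, i)%:R * y ^+ i.
Proof.
rewrite addrC exprDn; apply: eq_bigr => i _.
by rewrite expr1n mul1r mulr_natl.
Qed.

(** This evaluates the coefficient of [y ^+ p] in [(y + 1) ^+ p.+2], the last one needed for the
    top-degree cancellation. *)
Lemma bin2_natr (R : numFieldType) (p : nat) :
  'C(p.+2, p)%:R = p.+2%:R * p.+1%:R / 2 :> R.
Proof.
have := mul_bin_down p.+2 p; rewrite /= binSn -addn2 addKn.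
move=> /(congr1 (fun m => m%:R : R)); rewrite !natrM => ->.
by rewrite mulrAC mulfV ?mul1r ?pnatr_eq0.
Qed.

Section Coefficients.
Variable R : realFieldType.

Lemma euler_maclaurin_coef_ge0 (p i : nat) : (i < p)%N ->
  0 <= 'C(p.+2, i)%:R / p.+2%:R - 'C(p.+1, i)%:R / 2
       + p.+1%:R * 'C(p, i)%:R / 12 :> R.
Proof.
(* This [k] is the overview's k lowered by 3, so the factor (k - 3) (k - 4) there becomes k (k - 1).
   [B1] and [B2] reduce all binomials to multiples of [A]. *)
move=> ltip; have [k ->] : exists k, p = (i + k.+1)%N by exists (p - i.+1)%N; lia.
set q := (i + k.+1)%N; set A : R := 'C(q, i)%:R.
have B1 : 'C(q.+1, i)%:R = q.+1%:R * A / k.+2%:R.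
  have := mul_bin_down q.+1 i; rewrite /= (_ : (q.+1 - i = k.+2)%N); last by rewrite /q; lia.
  move=> /(congr1 (fun m => m%:R : R)); rewrite !natrM => ->.
  by rewrite mulrAC mulfV ?mul1r ?pnatr_eq0.
have B2 : 'C(q.+2, i)%:R = q.+2%:R * (q.+1%:R * A / k.+2%:R) / k.+3%:R.
  have := mul_bin_down q.+2 i; rewrite /= (_ : (q.+2 - i = k.+3)%N); last by rewrite /q; lia.
  move=> /(congr1 (fun m => m%:R : R)); rewrite !natrM B1 => ->.
  by rewrite mulrAC mulfV ?mul1r ?pnatr_eq0.
have k0 : 0 <= k%:R :> R by [].
have i0 : 0 <= i%:R :> R by [].
have -> : 'C(q.+2, i)%:R / q.+2%:R - 'C(q.+1, i)%:R / 2 + q.+1%:R * A / 12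
  = q.+1%:R * A * (k%:R * (k%:R - 1)) / (12 * k.+2%:R * k.+3%:R) :> R.
  rewrite B2 B1 -[k.+3]addn3 -[k.+2]addn2 -[q.+2]addn2 -[q.+1]addn1 !natrD.
  by field; apply/and3P; split; apply: lt0r_neq0; lra.
apply: divr_ge0; last by rewrite !mulr_ge0.
apply: mulr_ge0; first by rewrite mulr_ge0.
(* Integrality matters: k (k - 1) is negative for real k strictly between 0 and 1. *)
case: k {B1 B2 k0 ltip q A} => [|k]; first by rewrite mul0r.
by rewrite mulr_ge0 // subr_ge0 ler1n.
Qed.

(** These are the Euler-Maclaurin terms at the upper endpoint for f(t) = t^j: the antiderivative, f
    / 2 and f' / 12. *)
Definition power_sum_bound (j : nat) (x : R) : R :=
  x ^+ j.+1 / j.+1%:R + x ^+ j / 2 + j%:R * x ^+ j.-1 / 12.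

Lemma power_sum_bound_step (j : nat) (y : R) : (0 < j)%N -> 0 <= y ->
  power_sum_bound j y + (y + 1) ^+ j <= power_sum_bound j (y + 1).
Proof.
case: j => // p _ y0; rewrite /power_sum_bound /=.
rewrite -subr_ge0.
have -> : (y + 1) ^+ p.+2 / p.+2%:R + (y + 1) ^+ p.+1 / 2
    + p.+1%:R * (y + 1) ^+ p / 12
    - (y ^+ p.+2 / p.+2%:R + y ^+ p.+1 / 2 + p.+1%:R * y ^+ p / 12 + (y + 1) ^+ p.+1)
  = \sum_(i < p) ('C(p.+2, i)%:R / p.+2%:R - 'C(p.+1, i)%:R / 2
       + p.+1%:R * 'C(p, i)%:R / 12) * y ^+ i.
  rewrite (eq_bigr (fun i : 'I_p => p.+2%:R^-1 * ('C(p.+2, i)%:R * y ^+ i)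
     - 2^-1 * ('C(p.+1, i)%:R * y ^+ i) + p.+1%:R / 12 * ('C(p, i)%:R * y ^+ i)));
    last by move=> i _; ring.
  (* Every binomial sum is cut down to [i < p]; the peeled terms in [y ^+ p], [y ^+ p.+1] and
     [y ^+ p.+2] cancel. *)
  rewrite big_split sumrB /= -!mulr_sumr !exprD1n_bin !big_ord_recr /=.
  rewrite !binn !binSn bin2_natr.
  have p0 : 0 <= p%:R :> R by [].
  rewrite !exprS -[p.+2]addn2 -[p.+1]addn1 !natrD.
  by field; apply: lt0r_neq0; lra.
by apply: sumr_ge0 => i _; rewrite mulr_ge0 ?exprn_ge0 ?euler_maclaurin_coef_ge0.
Qed.

End Coefficients.

Theorem theorem2p4 (R : realType) (j n : nat) (r : R)
    (hj : (1 <= j)%N) (hn : (1 <= n)%N) (hr0 : 0 <= r) (hr1 : r <= 1) :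
  \sum_(1 <= i < n.+1) (i%:R + r) ^+ j <=
    (n%:R + r) ^+ j.+1 / j.+1%:R + (n%:R + r) ^+ j / 2
      + j%:R * (n%:R + r) ^+ j.-1 / 12.
Proof.
rewrite -/(power_sum_bound R j (n%:R + r)).
(* The induction starts from the empty sum, where the claim is that the bound at [r] is
   nonnegative. *)
elim: n {hn} => [|n IHn].
  rewrite big_nil add0r /power_sum_bound.
  by rewrite !addr_ge0 ?divr_ge0 ?mulr_ge0 ?exprn_ge0.
rewrite big_nat_recr //= -natr1 addrAC.
apply: le_trans (power_sum_bound_step _ _ _ hj (addr_ge0 (ler0n _ n) hr0)).
by rewrite lerD2r.
Qed.
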